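(* Let $G$ be a finite simple connected graph that is chordal, claw-free, and narrow. Then any labeling of $G$ produced by the Labeling Algorithm described below is closed.
   Context: A labeling of $G$ (with $n$ vertices) is a bijection $V(G)\to[n]$, identified with $V(G)=[n]$; it is closed if whenever $\{j,i\},\{i,k\}$ are distinct edges with either ($j>i$ and $k>i$) or ($j<i$ and $k<i$), then $\{j,k\}\in E(G)$. Chordal: every cycle of length at least $4$ has a chord. Claw-free: no induced subgraph isomorphic to $K_{1,3}$. $d(v,w)$ is shortest-path distance, $\mathrm{diam}(G)=\max_{v,w}d(v,w)$, and a longest shortest path is a shortest path joining two vertices at distance $\mathrm{diam}(G)$. Narrow: for every vertex $v$ and every longest shortest path $P$, either $v\in V(P)$ or $v$ is adjacent to a vertex of $P$. Labeling Algorithm: choose a vertex $v_0$ of minimal degree among all endpoints of longest shortest paths of $G$; label it $1$, let $J=\{v_0\}$, and let the next label be $i=2$. Then for $j=1,2,\dots,n$ in turn: let $S=N_G(j)\setminus J$ be the set of unlabeled neighbors of the vertex labeled $j$; while $S\neq\emptyset$, pick $v\in S$ minimizing $|N_G(v)\setminus J|$ over $S$ (ties broken arbitrarily), give $v$ the label $i$, increase $i$ by $1$, add $v$ to $J$ and remove $v$ from $S$. Here $N_G(v)$ is the set of neighbors of $v$. *)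

(* Defs.v *)
From mathcomp Require Import all_boot.

Set Implicit Arguments.
Unset Strict Implicit.
Unset Printing Implicit Defensive.

Section Graph.

Variables (T : finType) (e : rel T).
Implicit Types (lab : T -> nat) (s : seq T) (S : {set T}).

Definition connected_graph : Prop := forall x y, connect e x y.

Definition nbrs (v : T) : {set T} := [set w | e v w].

(* A path from x to y is x :: p, without repeated vertices; its length is
   size p. *)
Definition is_path_from_to (x y : T) (p : seq T) : bool :=
  [&& path e x p, last x p == y & uniq (x :: p)].

(* A path has fewer than #|T| edges, so the bound on k loses nothing; the
   value is #|T| when there is no path from x to y. *)
Definition dist (x y : T) : nat :=
  \big[minn/#|T|]_(k < #|T| | [exists p : k.-tuple T, is_path_from_to x y p]) k.

Definition diam : nat := \max_(x : T) \max_(y : T) dist x y.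

Definition longest_shortest_path (x y : T) (p : seq T) : Prop :=
  [/\ is_path_from_to x y p, size p = dist x y & dist x y = diam].

Definition narrow : Prop :=
  forall (v x y : T) (p : seq T), longest_shortest_path x y p ->
    v \in x :: p \/ exists2 w, w \in x :: p & e v w.

Definition has_chord (c : seq T) : Prop :=
  exists x y, [/\ x \in c, y \in c, e x y, y != next c x & x != next c y].

Definition chordal : Prop :=
  forall c : seq T, ucycle e c -> 4 <= size c -> has_chord c.

Definition complete_bipartite (m n : nat) : rel ('I_m + 'I_n) :=
  fun u v => match u, v with
             | inl _, inr _ | inr _, inl _ => true
             | _, _ => false
             end.

Definition has_induced (U : finType) (h : rel U) : Prop :=
  exists f : U -> T, injective f /\ forall u v, e (f u) (f v) = h u v.

Definition claw_free : Prop := ~ has_induced (@complete_bipartite 1 3).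

Definition is_labeling lab : Prop :=
  injective lab /\ forall k, 1 <= k <= #|T| <-> exists v, lab v = k.

Definition closed_labeling lab : Prop :=
  is_labeling lab /\
  forall i j k : T, e j i -> e i k -> j != k ->
    (lab j > lab i /\ lab k > lab i) \/ (lab j < lab i /\ lab k < lab i) ->
    e j k.

(* The state of the algorithm is the sequence s of the vertices labeled so far
   in the order of labeling: the vertex at position k of s has label k + 1, J is
   the set of the items of s and the next label is (size s).+1. *)
Definition unlabeled_nbrs s (v : T) : {set T} := nbrs v :\: [set:: s].

Inductive label_set : {set T} -> seq T -> seq T -> Prop :=
| LabelSetDone s : label_set set0 s s
| LabelSetStep S s s' v :
    v \in S ->
    (forall w, w \in S -> #|unlabeled_nbrs s v| <= #|unlabeled_nbrs s w|) ->
    label_set (S :\ v) (rcons s v) s' ->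
    label_set S s s'.

(* label_from j s s': the iterations j, j + 1, ..., #|T| of the main loop turn
   s into s'. *)
Inductive label_from : nat -> seq T -> seq T -> Prop :=
| LabelFromDone s : label_from #|T|.+1 s s
| LabelFromStep j s s1 s2 v :
    1 <= j <= #|T| ->
    onth s j.-1 = Some v ->
    label_set (unlabeled_nbrs s v) s s1 ->
    label_from j.+1 s1 s2 ->
    label_from j s s2.

Definition lsp_endpoint (v : T) : Prop :=
  exists x y p, longest_shortest_path x y p /\ (v = x \/ v = y).

Definition start_vertex (v : T) : Prop :=
  lsp_endpoint v /\ forall w, lsp_endpoint w -> #|nbrs v| <= #|nbrs w|.

Definition produced_by_algorithm lab : Prop :=
  exists v0 s, [/\ start_vertex v0, label_from 1 [:: v0] s
                 & forall v, lab v = (index v s).+1].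

End Graph.

(* Main.v *)
Require Import Defs.
From mathcomp Require Import all_boot zify.

Set Implicit Arguments.
Unset Strict Implicit.
Unset Printing Implicit Defensive.

(** Let [d] be the distance from the start vertex [v0].

    Every layer of [d] is a clique.  It suffices that a vertex [w] on a longest
    shortest path from [v0] is adjacent to its whole layer: if [x], [y] in the
    layer are both adjacent to [w], then either one of them is adjacent to the
    successor of [w], hence lies itself on such a path, or claw-freeness at [w]
    gives the edge.  In layer 1 the adjacency comes from the minimality of the
    degree of [v0]; in a higher layer it comes from narrowness, claw-freeness and
    the completeness of the preceding layer.

    The labels are a breadth-first order, hence nondecreasing in [d].  Inside a
    layer the neighbourhoods in the next layer are nested, since an induced
    4-cycle would arise otherwise, and they grow with the label: for children of
    one parent by the greedy choice, for children of different parents by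
    claw-freeness.  Consequently the neighbourhoods in the previous layer shrink
    with the label, and these two facts are what closedness requires of edges
    joining two layers. *)

(* [lia] preprocesses every boolean hypothesis, which is very slow when the
   context is full of adjacency facts. *)
Ltac nat_lia :=
  repeat match goal with
  | H : is_true (leq _ _) |- _ => revert H
  | H : @eq nat _ _ |- _ => revert H
  | H : dist _ _ _ = _ |- _ => revert H
  | H : is_true (~~ (@eq_op _ (dist _ _ _) _)) |- _ => revert H
  end; clear; lia.

(** * Minima and graph distance *)

Lemma bigmin_seq_le (I : eqType) (r : seq I) (P : pred I) (F : I -> nat) n k :
  k \in r -> P k -> \big[minn/n]_(i <- r | P i) F i <= F k.
Proof.
elim: r => // i r IH; rewrite inE big_cons => /orP[/eqP <- -> | kr Pk].
  exact: geq_minl.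
case: ifP => _; last exact: IH.
exact: leq_trans (geq_minr _ _) (IH kr Pk).
Qed.

Lemma bigmin_attained (I : Type) (r : seq I) (P : pred I) (F : I -> nat) n :
  \big[minn/n]_(i <- r | P i) F i = n \/
  exists2 k, P k & \big[minn/n]_(i <- r | P i) F i = F k.
Proof.
elim/big_rec: _ => [|i m Pi IH]; first by left.
by case: (leqP (F i) m) => _ //; right; exists i.
Qed.

Section Distance.

Variables (T : finType) (e : rel T).

Lemma uniq_path_lt_card (x : T) p : uniq (x :: p) -> size p < #|T|.
Proof. by move=> /card_uniqP /= <-; exact: max_card. Qed.

Lemma dist_le_size x p : path e x p -> dist e x (last x p) <= size p.
Proof.
case/shortenP=> p' p'path p'uniq p'sub.
have p'lt := uniq_path_lt_card p'uniq.
have p'le : size p' <= size p.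
  by move: p'uniq => /= /andP[_ u]; apply: uniq_leq_size => // z; exact: p'sub.
apply: leq_trans p'le; rewrite /dist.
apply: (@bigmin_seq_le _ _ _ (fun k : 'I_#|T| => k : nat) _ (Ordinal p'lt)).
  exact: mem_index_enum.
by apply/existsP; exists (in_tuple p'); rewrite /is_path_from_to /= p'path eqxx.
Qed.

Lemma dist_attained x y : connect e x y ->
  exists2 p, is_path_from_to e x y p & size p = dist e x y.
Proof.
case/connectP=> p ep ->; case: (shortenP ep) => p' p'path p'uniq _.
(* A simple path has fewer than [#|T|] edges, so the minimum is not its default value [#|T|]. *)
have lt_d := leq_ltn_trans (dist_le_size p'path) (uniq_path_lt_card p'uniq).
case: (@bigmin_attained _ (index_enum 'I_#|T|)
  (fun k : 'I_#|T| => [exists q : k.-tuple T, is_path_from_to e x (last x p') q])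
  (fun k : 'I_#|T| => k : nat) #|T|) => [dE|[k /existsP[q qP] dE]].
  by move: lt_d; rewrite /dist dE ltnn.
by exists q => //; rewrite size_tuple /dist dE.
Qed.

Lemma dist_le_diam x y : dist e x y <= diam e.
Proof.
apply: leq_trans (leq_bigmax x); exact: (leq_bigmax y).
Qed.

(** The relation is adjacency in the subgraph induced on [A], where [chordal_separation] takes its
    connectivity. *)
Lemma path_restrict (A : pred T) x p : path e x p -> A x -> all A p ->
  path (fun u v => [&& e u v, A u & A v]) x p.
Proof.
elim: p x => //= y p IH x /andP[-> ep] -> /andP[Ay Ap].
by rewrite Ay IH.
Qed.

Lemma dist_sym x y : symmetric e -> connected_graph e -> dist e x y = dist e y x.
Proof.
move=> e_sym e_conn.
suff le u v : dist e u v <= dist e v u by apply/eqP; rewrite eqn_leq !le.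
have [p /and3P[ep /eqP <- _] <-] := dist_attained (e_conn v u).
have := @dist_le_size (last v p) (rev (belast v p)).
rewrite rev_path (eq_path (e' := e)) // ep => /(_ isT).
rewrite size_rev size_belast; congr (dist _ _ _ <= _).
by case: p {ep} => //= z p; rewrite rev_cons last_rcons.
Qed.

End Distance.

(** * Claws and chordless cycles *)

Section ForbiddenSubgraphs.

Variables (T : finType) (e : rel T).
Hypotheses (e_sym : symmetric e) (e_irr : irreflexive e).

Lemma edge_neq x y : e x y -> x != y.
Proof. by apply: contraTneq => ->; rewrite e_irr. Qed.

Lemma claw_free_edge v a b c : claw_free e ->
  e v a -> e v b -> e v c -> a != b -> a != c -> b != c ->
  [|| e a b, e a c | e b c].
Proof.
move=> cf va vb vc nab nac nbc; apply/negPn/negP; rewrite !negb_or.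
case/and3P=> /negPf ab /negPf ac /negPf bc; apply: cf.
pose f (u : 'I_1 + 'I_3) :=
  match u with inl _ => v | inr i => nth a [:: a; b; c] i end.
have I3 (i : 'I_3) : [\/ i = inord 0, i = inord 1 | i = inord 2].
  by case: i => [[|[|[|i]]] lti] //; [constructor 1|constructor 2|constructor 3];
    apply: val_inj; rewrite /= inordK.
have f0 : f (inr (inord 0)) = a by rewrite /f inordK.
have f1 : f (inr (inord 1)) = b by rewrite /f inordK.
have f2 : f (inr (inord 2)) = c by rewrite /f inordK.
have fv i : f (inl i) = v by [].
have fE u w : e (f u) (f w) = complete_bipartite u w.
  case: u w => [i|i] [j|j]; rewrite ?fv ?e_irr //.
  - by case: (I3 j) => ->; rewrite ?f0 ?f1 ?f2.
  - by case: (I3 i) => ->; rewrite ?f0 ?f1 ?f2 e_sym.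
  - by case: (I3 i) => ->; case: (I3 j) => ->; rewrite ?f0 ?f1 ?f2 ?e_irr //;
      rewrite // e_sym.
exists f; split => //.
have nev w : e v w -> v = w -> False by move=> + E; rewrite E e_irr.
move=> [i|i] [j|j]; rewrite ?fv.
- by rewrite (ord1 i) (ord1 j).
- by case: (I3 j) => ->; rewrite ?f0 ?f1 ?f2 => /nev; case.
- by case: (I3 i) => ->; rewrite ?f0 ?f1 ?f2 => /esym/nev; case.
- by case: (I3 i) => ->; case: (I3 j) => ->; rewrite ?f0 ?f1 ?f2 // => E;
    move: nab nac nbc; rewrite E ?eqxx.
Qed.

Hypothesis e_chordal : chordal e.

Lemma next_mid (v x y : T) l1 l3 : uniq (v :: l1 ++ x :: y :: l3) ->
  next (v :: l1 ++ x :: y :: l3) x = y.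
Proof.
move=> u; rewrite next_nth inE mem_cat !inE eqxx !orbT.
have -> : index x (v :: l1 ++ x :: y :: l3) = (size l1).+1.
  rewrite -cat_cons index_cat -{1}[size l1]/(size (v :: l1)).-1.
  rewrite -[v :: _ ++ _]cat_cons cat_uniq in u; case/and3P: u => _ /hasPn u _.
  have := u x; rewrite inE eqxx => /(_ isT) /negPf /= ->.
  by rewrite eqxx addn0.
by rewrite nth_cat ltnNge leqnSn /= subSn // subnn.
Qed.

Lemma next_last (v : T) p : uniq (v :: p) -> next (v :: p) (last v p) = v.
Proof.
case/lastP: p => [|p b] u; first by rewrite /= eqxx.
rewrite last_rcons next_nth inE mem_rcons inE eqxx orbT.
have -> : index b (v :: rcons p b) = (size p).+1.
  move: u; rewrite -rcons_cons rcons_uniq => /andP[nb _].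
  by rewrite -cats1 index_cat (negPf nb) /= eqxx addn0.
by rewrite nth_default // size_rcons.
Qed.

(* A shortest path from [a] to [b] inside [A], closed up through [v], is a cycle
   without chords. *)
Lemma chordal_separation v (A : pred T) a b :
  ~~ A v -> A a -> A b -> e v a -> e v b ->
  (forall w, A w -> e v w -> w = a \/ w = b) ->
  connect (fun u w => [&& e u w, A u & A w]) a b -> a = b \/ e a b.
Proof.
set h := fun u w => _; move=> nAv Aa Ab va vb nvA /dist_attained[p /and3P[hp lp up] sp].
have ep : path e a p by apply: sub_path hp => u w /and3P[].
have Ap : all A p.
  elim: p a hp {Aa va nvA lp up sp ep} => //= y p IH a /andP[/and3P[_ _ ->] /IH].
  by [].
case: (leqP (size p) 1) => [|p2].
  case: p {sp up hp Ap} lp ep => [|y [|//]] /= /eqP <-; first by left.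
  by rewrite andbT; right.
exfalso; set c := v :: a :: p.
have AinP w : w \in a :: p -> A w.
  by rewrite inE => /orP[/eqP ->|] //; apply: (allP Ap).
have uc : uniq c.
  by rewrite /c cons_uniq up andbT; apply: contra nAv; exact: AinP.
have cyc : ucycle e c.
  rewrite /ucycle uc andbT /c /= va /= rcons_path ep (eqP lp) /=.
  by rewrite e_sym vb.
(* No chord leaves [v]: its only neighbours on the cycle are [a] and [b], and both are consecutive
   to it. *)
have nv y : y \in c -> e v y -> y != next c v -> v != next c y -> False.
  rewrite {1}/c inE => /orP[/eqP ->|yP vy]; first by rewrite e_irr.
  have [->|->] := nvA y (AinP _ yP) vy; first by rewrite /= eqxx eqxx.
  have := next_last uc; rewrite /= (eqP lp) -/c => ->.
  by rewrite eqxx.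
(* No chord joins two vertices of the path: it would be a shortcut inside [A], against the
   minimality of [p]. *)
have ord l1 l2 l3 x y : a :: p = l1 ++ x :: l2 ++ y :: l3 -> e x y ->
    y != next c x -> False.
  case: l2 => [|z l2] E exy.
    by rewrite cat0s in E; rewrite /c E next_mid ?eqxx // -E.
  move=> _; have Axy : h x y.
    by rewrite /h exy !AinP // E mem_cat inE ?mem_cat ?inE eqxx ?orbT.
  case: l1 E => [|a' l1] /= [E1 E2].
    have := @dist_le_size _ h a (y :: l3).
    move: hp lp sp; rewrite E2 -cat_cons cat_path last_cat /= -E1 in Axy * => hp lp sp.
    case/and3P: hp => _ _ hp; rewrite Axy hp /= (eqP lp) => /(_ isT).
    rewrite -sp size_cat /=; clear; lia.
  have := @dist_le_size _ h a (l1 ++ x :: y :: l3).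
  move: hp lp sp; rewrite E2 !cat_path /= !last_cat /= !cat_path /= !last_cat /=.
  case/and5P=> h1 h2 h3 h4 /andP[h5 h6] lp sp; rewrite h1 h2 Axy h6 (eqP lp) => /(_ isT).
  rewrite -sp !size_cat /= !size_cat /=; clear; lia.
have split2 x y : x \in a :: p -> y \in a :: p -> x != y ->
    exists l1 l2 l3, a :: p = l1 ++ x :: l2 ++ y :: l3 \/
                     a :: p = l1 ++ y :: l2 ++ x :: l3.
  move=> /splitPr[l1 l2]; rewrite mem_cat inE eq_sym => yP /negPf nxy.
  move: yP; rewrite nxy /= => /orP[] /splitPr[k1 k2].
    by exists k1, k2, l2; right; rewrite -catA.
  by exists l1, k1, k2; left.
have [x [y [xc yc exy nx ny]]] := e_chordal cyc (p2 : 3 < size c).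
move: (xc) (yc); rewrite {1 2}/c ![_ \in v :: _]inE => /orP[/eqP E|xP] /orP[/eqP E'|yP].
- by rewrite E E' e_irr in exy.
- by subst x; apply: nv yc exy nx ny.
- by subst y; apply: nv xc _ ny nx; rewrite e_sym.
have [l1 [l2 [l3 [E|E]]]] := split2 _ _ xP yP (edge_neq exy).
  exact: ord E exy nx.
by apply: ord E _ ny; rewrite e_sym.
Qed.

Lemma chordal_C4 a b c d : e a b -> e b c -> e c d -> e d a -> a != c -> b != d ->
  e a c || e b d.
Proof.
move=> ab bc cd da ac bd; case: (boolP (e b d)) => [_|nbd]; first by rewrite orbT.
have ba : e b a by rewrite e_sym.
(* Without the edge [b d], the neighbours of [b] in [A] are [a] and [c], which [d] connects. *)
pose A : pred T := pred3 a c d.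
have [] := @chordal_separation b A a c; rewrite ?orbF /A /= ?eqxx ?orbT //.
- by rewrite !negb_or bd (edge_neq ba) (edge_neq bc).
- move=> w /or3P[] /eqP -> ; [by left|by right|by rewrite (negPf nbd)].
- apply: (@connect_trans _ _ d); apply: connect1; rewrite !eqxx ?orbT /= ?andbT //.
    by rewrite e_sym.
  by rewrite e_sym.
- by move=> E; rewrite E eqxx in ac.
Qed.

End ForbiddenSubgraphs.

(** * The algorithm as a greedy breadth-first search *)

Section Algorithm.

Variables (T : finType) (e : rel T) (v0 : T).
Hypothesis e_sym : symmetric e.

(* [find (e u) s] is the position of the vertex from which [u] gets its label. *)
Definition greedy_bfs (s : seq T) : Prop :=
  forall u v, u \in s -> u != v0 -> index u s < index v s ->
    find (e u) s <= find (e v) s /\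
    (find (e u) s = find (e v) s ->
     #|unlabeled_nbrs e (take (index u s) s) u|
       <= #|unlabeled_nbrs e (take (index u s) s) v|).

(* The state of the algorithm while the vertex at position [q] is processed. *)
Definition bfs_invariant (s : seq T) (q : nat) : Prop :=
  [/\ uniq s, ohead s = Some v0,
      forall v, v \notin s -> q <= find (e v) s,
      forall u, u \in s -> u != v0 -> find (e u) s <= q
    & greedy_bfs s].

Lemma find_rcons_le (a : pred T) s v : find a s <= find a (rcons s v).
Proof.
rewrite -cats1 find_cat; case: ifP => // /negbT/hasNfind ->; exact: leq_addr.
Qed.

Lemma find_rcons_lt (a : pred T) s v :
  find a s < size s -> find a (rcons s v) = find a s.
Proof. by rewrite -has_find -cats1 find_cat => ->. Qed.

Lemma find_le_nth (a : pred T) s q : a (nth v0 s q) -> find a s <= q.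
Proof. by move=> aq; rewrite leqNgt; apply/negP => /(before_find v0); rewrite aq. Qed.

Lemma bfs_invariant_step s q v :
  bfs_invariant s q -> q < size s -> v \notin s -> e v (nth v0 s q) ->
  (forall w, w \notin s -> e w (nth v0 s q) ->
    #|unlabeled_nbrs e s v| <= #|unlabeled_nbrs e s w|) ->
  bfs_invariant (rcons s v) q.
Proof.
move=> [us hs out inn gr] qs vs ev mv.
(* The invariant gives [q] as a lower bound because [v] was unlabeled; adjacency to position [q]
   gives the upper bound. *)
have Fv : find (e v) (rcons s v) = q.
  have E : find (e v) s = q by apply/eqP; rewrite eqn_leq out // find_le_nth.
  by rewrite find_rcons_lt E.
have Fin u : u \in s -> u != v0 -> find (e u) (rcons s v) = find (e u) s.
  by move=> uin uv; rewrite find_rcons_lt //; apply: leq_ltn_trans qs; exact: inn.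
split.
- by rewrite rcons_uniq vs.
- by case: (s) hs.
- move=> w; rewrite mem_rcons inE negb_or => /andP[_ ws].
  exact: leq_trans (out w ws) (find_rcons_le _ _ _).
- move=> u; rewrite mem_rcons inE => /orP[/eqP -> _|us' uv]; first by rewrite Fv.
  by rewrite Fin // inn.
move=> u w; rewrite mem_rcons inE => /orP[/eqP -> _|uin uv].
  have iv : index v (rcons s v) = size s.
    by rewrite -cats1 index_cat (negPf vs) /= eqxx addn0.
  rewrite iv => ltw.
  (* Only vertices still unlabeled can come after the newest vertex [v], so the greedy choice of [v]
     applies to [w]. *)
  have ws : w \notin s.
    apply: contraTN ltw => ws; rewrite -cats1 index_cat ws -leqNgt.
    by rewrite ltnW // index_mem.
  split; first by rewrite Fv (leq_trans (out w ws)) ?find_rcons_le.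
  rewrite Fv -cats1 take_size_cat // => Fw; apply: mv => //.
  have hw : has (e w) (rcons s v).
    by rewrite has_find size_rcons -cats1 -Fw; nat_lia.
  have := nth_find v0 hw; rewrite -cats1 -Fw nth_cat qs; exact.
have iu : index u (rcons s v) = index u s by rewrite -cats1 index_cat uin.
have lu : index u s < size s by rewrite index_mem.
have tu : take (index u s) (rcons s v) = take (index u s) s.
  by rewrite -cats1 takel_cat // ltnW.
rewrite iu tu Fin // => ltw.
have ltw' : index u s < index w s.
  move: ltw; rewrite -cats1 index_cat; case: ifP => // /negbT ws _.
  by rewrite (memNindex ws).
have [le1 le2] := gr u w uin uv ltw'.
split; first exact: leq_trans le1 (find_rcons_le _ _ _).
move=> E; apply: le2; apply/eqP; rewrite eqn_leq le1 /= E; exact: find_rcons_le.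
Qed.

(** [S] remains the set of unlabeled neighbours of the vertex at position [q]. Its being empty at
    the end is the last conclusion, which allows [q] to advance. *)
Lemma label_set_invariant S s s' q : label_set e S s s' ->
  bfs_invariant s q -> q < size s -> S = unlabeled_nbrs e s (nth v0 s q) ->
  [/\ bfs_invariant s' q, q < size s' & forall v, v \notin s' -> ~~ e v (nth v0 s' q)].
Proof.
elim=> {S s s'} [s|S s s' v vS mv _ IH] inv qs SE.
  split => // v vs; apply/negP => ev.
  by have := in_set0 v; rewrite SE !inE vs e_sym ev.
move: (vS); rewrite SE !inE => /andP[vs ev].
have nE : nth v0 (rcons s v) q = nth v0 s q by rewrite nth_rcons qs.
apply: IH; last first.
- rewrite nE SE; apply/setP => w; rewrite !inE mem_rcons inE negb_or.
  by rewrite andbA.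
- by rewrite size_rcons ltnW.
apply: bfs_invariant_step => //; first by rewrite e_sym.
by move=> w ws ew; apply: mv; rewrite SE !inE ws e_sym.
Qed.

Lemma label_from_invariant j s s' : label_from e j s s' ->
  bfs_invariant s j.-1 -> 0 < j -> j.-1 <= size s ->
  bfs_invariant s' #|T| /\ #|T| <= size s'.
Proof.
elim=> {j s s'} [s|j s s1 s2 v jT sj ls _ IH] inv j0 js; first by [].
have qs : j.-1 < size s.
  by rewrite ltnNge; apply/negP => le; move: sj; rewrite onth_default.
have vE : nth v0 s j.-1 = v by apply: (@onth_nth _ _ _ _ _ sj).
have [|inv1 q1 nb1] := label_set_invariant ls inv qs; first by rewrite vE.
apply: IH => //=; last by rewrite -(prednK j0).
case: inv1 => u1 h1 out inn gr; split => //.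
  (* An unlabeled [w] whose first labeled neighbour were at [j.-1] would have been labeled in this
     round. *)
  move=> w ws; have := out w ws; rewrite leq_eqVlt => /orP[/eqP E|]; last by nat_lia.
  have hw : has (e w) s1 by rewrite has_find -E.
  by have := nth_find v0 hw; rewrite -E (negPf (nb1 w ws)).
move=> w ws wv; apply: leq_trans (inn w ws wv) _; exact: leq_pred.
Qed.

Lemma label_from_output s : label_from e 1 [:: v0] s ->
  [/\ uniq s, forall v, v \in s, index v0 s = 0 & greedy_bfs s].
Proof.
move=> /label_from_invariant[] //.
  by split => // [u|u w]; rewrite inE => /eqP -> /eqP.
case=> us hs _ _ gr le; split => //; last by case: (s) hs => //= x t [->]; rewrite eqxx.
have sub : s \subset T by apply: subset_predT.
have cE : #|s| = #|T|.
  by apply/eqP; rewrite eqn_leq max_card (card_uniqP us).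
by move=> v; rewrite (subset_cardP cE sub).
Qed.

End Algorithm.

(** * The distance layers of the start vertex are cliques *)

Section Layers.

Variables (T : finType) (e : rel T) (v0 : T).
Hypotheses (e_sym : symmetric e) (e_irr : irreflexive e).
Hypotheses (e_conn : connected_graph e) (e_chordal : chordal e).
Hypotheses (e_claw_free : claw_free e) (e_narrow : narrow e).
Hypothesis v0_start : start_vertex e v0.

Local Notation d := (dist e v0).

Lemma depth_attained x : exists p, [/\ path e v0 p, last v0 p = x & size p = d x].
Proof.
by have [p /and3P[ep /eqP lp _] sp] := dist_attained (e_conn v0 x); exists p.
Qed.

Lemma depth_root : d v0 = 0.
Proof. by apply/eqP; rewrite -leqn0; exact: (@dist_le_size _ e v0 [::]). Qed.

Lemma depth_eq0 x : d x = 0 -> x = v0.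
Proof.
by have [p [_ <- <-]] := depth_attained x => /size0nil ->.
Qed.

Lemma depth_path x p : path e x p -> d (last x p) <= d x + size p.
Proof.
have [p0 [ep0 <- <-]] := depth_attained x => ep.
by rewrite -last_cat -size_cat; apply: dist_le_size; rewrite cat_path ep0.
Qed.

Lemma depth_edge x y : e x y -> d y <= (d x).+1.
Proof. by move=> exy; have := @depth_path x [:: y]; rewrite /= exy addn1; apply. Qed.

Lemma depth_pred x m : d x = m.+1 -> exists2 w, e w x & d w = m.
Proof.
have [p [ep lp sp]] := depth_attained x; rewrite -sp.
case/lastP: p ep lp {sp} (sp) => [|p y]; first by [].
rewrite rcons_path last_rcons size_rcons => /andP[ep ey] yx sx [pm]; subst y.
exists (last v0 p) => //; have := depth_edge ey; have := dist_le_size ep.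
nat_lia.
Qed.

(** Depth rises by at most one per edge, so a path whose total rise equals its length rises at every
    edge. *)
Lemma geodesic_tail x p : path e x p -> d (last x p) = d x + size p ->
  all (fun w => d x < d w) p.
Proof.
elim: p x => //= y p IH x /andP[exy ep] E.
have le1 := depth_edge exy; have le2 := depth_path ep.
have dy : d y = (d x).+1 by nat_lia.
rewrite dy leqnn /=.
have /allP A : all (fun w => d y < d w) p by apply: IH => //; nat_lia.
by apply/allP => w /A; rewrite dy => /ltnW.
Qed.

Lemma geodesic_inj x p : path e x p -> d (last x p) = d x + size p ->
  {in x :: p &, injective d}.
Proof.
elim: p x => [|y p IH] x ep E t t'; rewrite inE.
  by move=> /eqP -> ; rewrite inE => /eqP ->.
have /allP A := geodesic_tail ep E.
move: ep E => /= /andP[exy ep] E.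
have le1 := depth_edge exy; have le2 := depth_path ep.
have {}IH : {in y :: p &, injective d} by apply: IH => //; nat_lia.
move=> /orP[/eqP -> |tp]; rewrite inE => /orP[/eqP -> |tp'] // dE.
- by have := A _ tp'; rewrite dE ltnn.
- by have := A _ tp; rewrite dE ltnn.
- exact: IH.
Qed.

Lemma geodesic_uniq x p : path e x p -> d (last x p) = d x + size p ->
  uniq (x :: p).
Proof.
elim: p x => // y p IH x ep E; rewrite cons_uniq.
have /allP A := geodesic_tail ep E; apply/andP; split.
  by apply/negP => /A; rewrite ltnn.
move: ep E => /= /andP[exy ep] E.
have le1 := depth_edge exy; have le2 := depth_path ep.
by apply: IH => //; nat_lia.
Qed.

(** These are the longest shortest paths from [v0]; having no repeated vertex is left out, since
    [geodesic_uniq] recovers it. *)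
Definition diametral p : Prop :=
  [/\ path e v0 p, size p = diam e & d (last v0 p) = diam e].

Lemma diametral_geodesic p : diametral p -> d (last v0 p) = d v0 + size p.
Proof. by case=> _ -> ->; rewrite depth_root. Qed.

Lemma diametral_inj p : diametral p -> {in v0 :: p &, injective d}.
Proof.
by move=> dp; case: (dp) => ep _ _; apply: geodesic_inj (diametral_geodesic dp).
Qed.

Lemma diametral_narrow p x : diametral p ->
  x \in v0 :: p \/ exists2 w, w \in v0 :: p & e x w.
Proof.
move=> dp; case: (dp) => ep sp lp; apply: (@e_narrow x v0 (last v0 p)).
split; rewrite ?lp //.
by rewrite /is_path_from_to ep eqxx geodesic_uniq // diametral_geodesic.
Qed.

(** The prefix bounds the depth of [w] from above, and the suffix, which must still reach depth
    [diam e], bounds it from below. *)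
Lemma diametral_depth p1 w p2 : diametral (p1 ++ w :: p2) ->
  d w = (size p1).+1 /\ d w + size p2 = diam e.
Proof.
case; rewrite cat_path last_cat size_cat /= => /and3P[ep1 ew ep2] sp lp.
have := depth_path ep2; rewrite lp; have := depth_edge ew.
have := dist_le_size ep1; nat_lia.
Qed.

Lemma exists_deepest : exists z, d z = diam e.
Proof.
have [[x [y [p [[_ _ dE] [->|->]]]]] _] := v0_start; first by exists y.
by exists x; rewrite dist_sym.
Qed.

(* If [y] were not adjacent to [w], chordality would separate [y] from [w]
   outside the neighbourhood of [v0], making [y] another endpoint of a longest
   shortest path; minimality of the degree of [v0] then yields a neighbour of
   [y] at depth 2, which narrowness links back to the path. *)
Lemma diametral_adj_layer1 w p y : diametral (w :: p) -> d y = 1 -> y != w -> e y w.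
Proof.
move=> dp dy yw; apply/negPn/negP => nyw.
have [dw _] := @diametral_depth [::] _ _ dp; rewrite /= in dw.
case: (dp) => /= /andP[v0w ep] sp lp.
have tail_p : all (fun u => 1 < d u) p.
  by rewrite -dw; apply: geodesic_tail => //; rewrite lp -sp dw.
have v0y : e v0 y by have [v] := depth_pred dy => + /depth_eq0 E; rewrite E.
pose A u := [|| u == y, u == w | 1 < d u].
pose h u v := [&& e u v, A u & A v].
have h_sym : connect_sym h.
  by apply: sym_connect_sym => u v; rewrite /h e_sym [A u && _]andbC.
have Ay : A y by rewrite /A eqxx.
have Aw : A w by rewrite /A eqxx orbT.
have A2 u : 1 < d u -> A u by rewrite /A => ->; rewrite !orbT.
have sep : ~ connect h y w.
  move=> cyw; have [|||||||E|E] := @chordal_separation _ e e_sym e_irr e_chordal v0 A y w.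
  - rewrite /A depth_root orbF negb_or; apply/andP.
    by split; apply/eqP => E; [move: dy|move: dw]; rewrite -E depth_root.
  - exact: Ay.
  - exact: Aw.
  - exact: v0y.
  - exact: v0w.
  - move=> u /or3P[/eqP ->|/eqP ->|du] v0u; [by left|by right|].
    by have := depth_edge v0u; rewrite depth_root leqNgt du.
  - exact: cyw.
  - by rewrite E eqxx in yw.
  - by rewrite E in nyw.
have to_p u : u \in w :: p -> connect h w u.
  apply: path_connect; apply: path_restrict => //.
  by apply: sub_all tail_p => v; exact: A2.
(* A shorter path from [y] would have to gain depth at every edge, hence stay in [A] and connect [y]
   to [w]. *)
have dyz : dist e y (last w p) = diam e.
  apply/eqP; rewrite eqn_leq dist_le_diam leqNgt; apply/negP => lt.
  have [q /and3P[eq /eqP lq _] sq] := dist_attained (e_conn y (last w p)).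
  have := depth_path eq; rewrite lq lp dy sq => le.
  apply: sep; apply: (@connect_trans _ _ (last w p)); last first.
    by rewrite h_sym to_p // mem_last.
  rewrite -lq; apply: (@path_connect _ h); last exact: mem_last.
  apply: path_restrict => //.
  apply: (@sub_all _ (fun u => d y < d u)) => [u|]; first by rewrite dy; exact: A2.
  by apply: geodesic_tail => //; rewrite lq lp dy sq; nat_lia.
have y_end : lsp_endpoint e y.
  have [q qP sq] := dist_attained (e_conn y (last w p)).
  by exists y, (last w p), q; split; [split|left].
have [z yz dz] : exists2 z, e y z & 1 < d z.
  have [_ /(_ y y_end)] := v0_start => le.
  have [/existsP[z /andP[yz dz]]|no] := boolP [exists z, e y z && (1 < d z)].
    by exists z.
  (* Otherwise [y] has fewer neighbours than [v0]: compared with those of [v0], it gains [v0] but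
     loses both [y] and [w]. *)
  have sub : nbrs e y \subset (v0 |: nbrs e v0) :\ y :\ w.
    apply/subsetP => u; rewrite !inE => yu.
    rewrite [u == y]eq_sym (edge_neq e_irr yu) /=.
    have -> /= : u != w by apply: contraNneq nyw => <-.
    have du : d u <= 1.
      by rewrite leqNgt; apply: contra no => du; apply/existsP; exists u; rewrite yu.
    case dE: (d u) du => [|[|//]] _; first by rewrite (depth_eq0 dE) eqxx.
    by have [v] := depth_pred dE => + /depth_eq0 E; rewrite E => ->; rewrite orbT.
  have := leq_trans le (subset_leq_card sub).
  have := cardsU1 v0 (nbrs e v0); rewrite inE e_irr /=.
  rewrite (cardsD1 y) !inE v0y orbT (cardsD1 w) !inE v0w orbT eq_sym yw /=.
  nat_lia.
have hyz : connect h y z by apply: connect1; rewrite /h yz Ay A2.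
have zw : ~ connect h z w by move=> c; apply: sep; exact: connect_trans hyz c.
have Ap u : u \in w :: p -> A u.
  by rewrite inE => /orP[/eqP ->|/(allP tail_p) /A2].
have [|[t]] := diametral_narrow z dp.
  rewrite inE => /orP[/eqP E|zp]; first by rewrite E depth_root in dz.
  by apply: zw; rewrite h_sym to_p.
rewrite inE => /orP[/eqP ->|tp] zt.
  have := @depth_edge v0 z; rewrite e_sym zt depth_root => /(_ isT); nat_lia.
apply: zw; apply: (@connect_trans _ _ t).
  by apply: connect1; rewrite /h zt A2 // Ap.
by rewrite h_sym to_p.
Qed.

Lemma diametral_adj_step p1 w' w p2 x : diametral (p1 ++ w' :: w :: p2) ->
  (forall u v, d u = d w' -> d v = d w' -> u != v -> e u v) ->
  d x = d w -> x != w -> e x w.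
Proof.
move=> dp clique dx xw.
have [dw' _] := diametral_depth dp.
have dp' : diametral (rcons p1 w' ++ w :: p2) by rewrite cat_rcons.
have [dw sp2] := diametral_depth dp'; rewrite size_rcons -dw' in dw.
have w'P : w' \in v0 :: p1 ++ w' :: w :: p2 by rewrite !(inE, mem_cat) eqxx !orbT.
have wP : w \in v0 :: p1 ++ w' :: w :: p2 by rewrite !(inE, mem_cat) eqxx !orbT.
have w'w : e w' w by case: (dp) => + _ _; rewrite cat_path /= => /and4P[].
have ne u v : d u != d v -> u != v by apply: contraNneq => ->.
have nfar u v : (d u).+1 < d v -> e u v = false.
  by move=> lt; apply/negP => /depth_edge; rewrite leqNgt lt.
(* A predecessor [t] of [u] is two layers away from [x] and [w], so the claw at [u] with leaves [x],
   [w], [t] forces the edge [x w]. *)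
have common u : d u = d w' -> e u x -> e u w -> e x w.
  move=> du ux uw; rewrite dw' in du.
  have [t tu dt] := depth_pred du; rewrite e_sym in tu.
  have /or3P[//| |] := claw_free_edge e_sym e_irr e_claw_free ux uw tu xw
    (ne x t ltac:(nat_lia)) (ne w t ltac:(nat_lia)); rewrite e_sym nfar //; nat_lia.
have [xP|[t tP xt]] := diametral_narrow x dp.
  by rewrite (diametral_inj dp xP wP dx) eqxx in xw.
have dtx : d t <= (d x).+1 by exact: depth_edge.
have dxt : d x <= (d t).+1 by apply: depth_edge; rewrite e_sym.
(* By depth, [t] is [w'], [w] or the successor [c] of [w] on the path; only the last case needs more
   work. *)
have [E|E] := eqVneq (d t) (d w').
  apply: (common w') => //; rewrite -(diametral_inj dp tP w'P E).
  by rewrite e_sym.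
have [E1|E1] := eqVneq (d t) (d w); first by rewrite -(diametral_inj dp tP wP E1).
have dt : d t = (d w).+1 by nat_lia.
case: p2 dp dp' sp2 w'P wP tP => [|c p2] dp dp' sp2 w'P wP tP.
  have := dist_le_diam e v0 t; rewrite /= in sp2; nat_lia.
have cP : c \in v0 :: p1 ++ [:: w', w, c & p2] by rewrite !(inE, mem_cat) eqxx !orbT.
have dp'' : diametral (rcons (rcons p1 w') w ++ c :: p2) by rewrite !cat_rcons.
have [dc _] := diametral_depth dp''; rewrite !size_rcons -dw' -dw in dc.
have tc : t = c by apply: (diametral_inj dp) => //; rewrite dt dc.
subst t; have wc : e w c by case: (dp) => + _ _; rewrite cat_path /= => /and5P[].
have [u ux du] : exists2 u, e u x & d u = d w' by apply: depth_pred; rewrite dx dw.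
have [uw|uw] := boolP (e u w); first exact: (common u).
have [uE|uw'] := eqVneq u w'; first by rewrite uE w'w in uw.
(* The 5-cycle [u x c w w'] needs a chord; separation at [u] yields the edge [x w'], so [w'] is a
   common neighbour of [x] and [w]. *)
pose A := pred4 x c w w'.
have [|||||||E2|E2] := @chordal_separation _ e e_sym e_irr e_chordal u A x w'.
- by rewrite /A /= !negb_or uw' !ne // ?du; nat_lia.
- by rewrite /A /= eqxx.
- by rewrite /A /= eqxx !orbT.
- exact: ux.
- exact: clique.
- move=> v /or4P[] /eqP ->; [by left| | |by right].
    by rewrite nfar // du; nat_lia.
  by rewrite (negPf uw).
- apply: (@connect_trans _ _ c).
    by apply: connect1; rewrite xt /A /= !eqxx !orbT.
  apply: (@connect_trans _ _ w); apply: connect1.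
    by rewrite e_sym wc /A /= !eqxx !orbT.
  by rewrite e_sym w'w /A /= !eqxx !orbT.
- by move: dx; rewrite E2; nat_lia.
- by apply: (common w') => //; rewrite e_sym.
Qed.

(** The prefix up to [w] is exchanged for a shortest path to [x], which has the same length. *)
Lemma diametral_replace p1 w c p2 x : diametral (p1 ++ w :: c :: p2) ->
  d x = d w -> e x c -> exists p, diametral (p ++ x :: c :: p2).
Proof.
move=> dp dx xc; have [dw _] := diametral_depth dp.
have [p [ep lp sp]] := depth_attained x.
case/lastP: p ep lp sp => [|p x'] + + sp; first by rewrite dx dw in sp.
rewrite last_rcons => ep E; subst x'; exists p.
case: dp; rewrite !cat_path size_cat last_cat /= => /and4P[_ _ _ ep2] sz ls.
split; rewrite ?last_cat //=.
  by rewrite -cat_rcons cat_path ep last_rcons /= xc.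
by rewrite -sz size_cat /=; move: sp; rewrite dx dw size_rcons; nat_lia.
Qed.

Lemma layer_clique x y : d x = d y -> x != y -> e x y.
Proof.
move E: (d x) => i; elim: i x y E => [|i IH] x y dx dy xy.
  by rewrite (depth_eq0 dx) (depth_eq0 (esym dy)) eqxx in xy.
(* A vertex of a diametral path is adjacent to its whole layer; it remains to place [x] or [y] on
   such a path, or to use a claw. *)
have near p1 w p2 u : diametral (p1 ++ w :: p2) -> d w = i.+1 -> d u = i.+1 ->
    u != w -> e u w.
  case/lastP: p1 => [|p1 w'] dp dw du.
    have [dw1 _] := diametral_depth dp.
    by apply: diametral_adj_layer1 dp _; rewrite du -dw.
  have [dw1 _] := diametral_depth dp.
  rewrite cat_rcons in dp; have [dw' _] := diametral_depth dp.
  rewrite size_rcons in dw1.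
  apply: diametral_adj_step dp _ _; last by rewrite du.
  by move=> a b da db; apply: IH; nat_lia.
have [z dz] := exists_deepest.
have [p [ep lp sp]] := depth_attained z.
have ip : i < size p by rewrite sp dz -dx dist_le_diam.
have dp : diametral p by split; rewrite // ?lp ?sp.
move: dp; rewrite -(cat_take_drop i p) (drop_nth v0 ip).
move: (take i p) (nth v0 p i) (drop i.+1 p) (size_takel (ltnW ip)).
move=> p1 w p2 sp1 dp; have [dw sp2] := diametral_depth dp; rewrite sp1 in dw.
(* If [w] ends the path, the layer has depth [diam e] and every shortest path to [y] is
   diametral. *)
case: p2 dp sp2 => [|c p2] dp sp2.
  have [q [eq lq sq]] := depth_attained y.
  case/lastP: q eq lq sq => [|q y'] + + sq; first by rewrite -dy in sq.
  rewrite last_rcons => eq yE; subst y'.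
  apply: (near q _ [::]) => //; rewrite cats1; split=> //; rewrite ?last_rcons.
    by rewrite sq -dy -dw -sp2 addn0.
  by rewrite -dy -dw -sp2 addn0.
have [xw|xw] := eqVneq x w.
  by rewrite e_sym; subst w; apply: (near p1 x (c :: p2)) => //; rewrite eq_sym.
have [yw|yw] := eqVneq y w; first by subst w; apply: (near p1 y (c :: p2)).
have [xc|xc] := boolP (e x c).
  have [|q dq] := diametral_replace dp _ xc; first by rewrite dx.
  by rewrite e_sym; apply: near dq _ _ _ => //; rewrite eq_sym.
have [yc|yc] := boolP (e y c).
  have [|q dq] := diametral_replace dp _ yc; first by rewrite -dy.
  exact: near dq _ _ _.
have ew u : d u = i.+1 -> u != w -> e w u.
  by move=> du uw; rewrite e_sym; apply: near dp _ _ _.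
have wc : e w c by case: dp => + _ _; rewrite cat_path /= => /and4P[].
have dc : d c = i.+2.
  have dp' : diametral (rcons p1 w ++ c :: p2) by rewrite cat_rcons.
  by have [-> _] := diametral_depth dp'; rewrite size_rcons sp1.
have ne u : d u = i.+1 -> u != c.
  by move=> du; apply/eqP => E; move: du; rewrite E dc; nat_lia.
(* Neither [x] nor [y] is adjacent to [c], so the claw at [w] leaves only the edge [x y]. *)
have := claw_free_edge e_sym e_irr e_claw_free (ew x dx xw) (ew y (esym dy) yw) wc
  xy (ne x dx) (ne y (esym dy)).
by rewrite (negPf xc) (negPf yc) !orbF.
Qed.

(** * Closedness of greedy breadth-first labelings *)

Section Closed.

Variable s : seq T.
Hypotheses (s_uniq : uniq s) (s_full : forall v, v \in s).
Hypotheses (s_root : index v0 s = 0) (s_bfs : greedy_bfs e v0 s).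

Local Notation pos v := (index v s).
Local Notation parent v := (nth v0 s (find (e v) s)).

Lemma pos_inj : injective (fun v => pos v).
Proof. by move=> u v E; rewrite -(nth_index v0 (s_full u)) E nth_index. Qed.

Lemma find_le_pos v w : e v w -> find (e v) s <= pos w.
Proof. by move=> vw; apply: (@find_le_nth _ v0); rewrite nth_index. Qed.

Lemma parentP u : u != v0 -> e u (parent u) /\ pos (parent u) = find (e u) s.
Proof.
move=> uv; case dE: (d u) => [|m]; first by rewrite (depth_eq0 dE) eqxx in uv.
have [w wu _] := depth_pred dE.
have hu : has (e u) s by apply/hasP; exists w => //; rewrite e_sym.
by split; [exact: nth_find | rewrite index_uniq // -has_find].
Qed.

(** Induction on the depth of [v]: the parent of [u] comes no later than any predecessor [w] of [v],
    so it is no deeper than [w]. *)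
Lemma depth_mono u v : pos u <= pos v -> d u <= d v.
Proof.
move E: (d v) => m; elim: m u v E => [|m IH] u v dv le.
  have uE : u = v0.
    by apply: pos_inj; move: le; rewrite /= (depth_eq0 dv) s_root leqn0 => /eqP.
  by rewrite uE depth_root.
have [->|uv0] := eqVneq u v0; first by rewrite depth_root.
have [->|uv] := eqVneq u v; first by rewrite dv.
have lt : pos u < pos v.
  by rewrite ltn_neqAle le andbT; apply: contra uv => /eqP /pos_inj ->.
have [w wv dw] := depth_pred dv; rewrite e_sym in wv.
have [fle _] := s_bfs (s_full u) uv0 lt.
have [eu pu] := parentP uv0; rewrite e_sym in eu.
apply: leq_trans (depth_edge eu) _; rewrite ltnS; apply: (IH _ w dw).
by rewrite pu (leq_trans fle) ?find_le_pos.
Qed.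

Lemma depth_parent u m : d u = m.+1 -> d (parent u) = m.
Proof.
move=> du; have uv0 : u != v0 by apply: contra_eqN du => /eqP ->; rewrite depth_root.
have [w wu dw] := depth_pred du; have [eu pu] := parentP uv0.
have le1 : d (parent u) <= d w.
  by apply: depth_mono; rewrite pu find_le_pos // e_sym.
rewrite e_sym in eu; have := depth_edge eu; nat_lia.
Qed.

Lemma later_nbr_above i j k : d i = d j -> pos i < pos j -> e i k -> d k = (d i).+1 ->
  e j k.
Proof.
move=> dij ltij ik dk; apply/negPn/negP => njk.
case di: (d i) => [|l].
  move: ltij; have iv0 := depth_eq0 di; rewrite dij in di.
  by rewrite iv0 (depth_eq0 di) ltnn.
have iv0 : i != v0 by apply: contra_eqN di => /eqP ->; rewrite depth_root.
have nij : i != j by apply: contraTneq ltij => ->; rewrite ltnn.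
have eij : e i j by apply: layer_clique.
have njk' : j != k by apply/eqP => E; move: dk; rewrite -E; nat_lia.
have [fle card_le] := s_bfs (s_full i) iv0 ltij.
have [ei pi] := parentP iv0; have dpi := depth_parent di.
(* If the parent of [i] is strictly earlier, it is not adjacent to [j], and [i] is the centre of a
   claw with leaves this parent, [j] and [k]. *)
move: fle; rewrite leq_eqVlt => /orP[/eqP feq|flt]; last first.
  have npj : parent i != j by apply/eqP => E; move: dpi; rewrite E; nat_lia.
  have npk : parent i != k by apply/eqP => E; move: dpi; rewrite E; nat_lia.
  have := claw_free_edge e_sym e_irr e_claw_free ei eij ik npj npk njk'.
  rewrite (negPf njk) orbF e_sym (before_find v0 flt) /=.
  by move=> /depth_edge; nat_lia.
(* With a common parent, the greedy choice of [i] is contradicted by [#|B| < #|A|]: exchanging [i]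
   for [k] in [B] gives a subset of [A] that misses [j]. *)
have {card_le} := card_le feq; rewrite leqNgt => /negP; apply.
have notJ w : (w \in take (pos i) s) = (pos w < pos i).
  by rewrite in_take // ?index_mem.
set A := unlabeled_nbrs _ _ i; set B := unlabeled_nbrs _ _ j.
have ltik : pos i < pos k.
  by rewrite ltnNge; apply/negP => /depth_mono; nat_lia.
have iB : i \in B by rewrite !inE notJ ltnn e_sym.
have jA : j \in A by rewrite !inE notJ eij andbT -leqNgt ltnW.
have kB : k \notin B :\ i by rewrite !inE (negPf njk) !andbF.
have sub : k |: B :\ i \subset A :\ j.
  apply/subsetP => w; rewrite !inE !notJ => /orP[/eqP ->|/and3P[wi nlt jw]].
    by rewrite eq_sym njk' ik andbT -leqNgt ltnW.
  rewrite eq_sym (edge_neq e_irr jw) nlt /=; rewrite -leqNgt in nlt.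
  have le1 := depth_mono nlt; have le2 := depth_edge jw.
  have [dw|dw] := eqVneq (d i) (d w); first by apply: layer_clique; rewrite // eq_sym.
  (* Here [w] lies in the layer of [k], and the 4-cycle [i j w k] has no chord [j k], so it has the
     chord [i w]. *)
  have nwk : w != k by apply: contraNneq njk => <-.
  have wk : e w k by apply: layer_clique => //; nat_lia.
  have ki : e k i by rewrite e_sym.
  have iw : i != w by rewrite eq_sym.
  have := chordal_C4 e_sym e_irr e_chordal eij jw wk ki iw njk'.
  by rewrite (negPf njk) orbF.
have := subset_leq_card sub; rewrite cardsU1 kB (cardsD1 j A) jA (cardsD1 i B) iB.
nat_lia.
Qed.

(** The parent of [j] comes no later than [k] and lies in the same layer; if it is not [k], its
    neighbour [j] above is also a neighbour of [k] by [later_nbr_above]. *)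
Lemma earlier_nbr_below i j k : d i = d j -> pos j < pos i -> e i k -> d i = (d k).+1 ->
  e j k.
Proof.
move=> dij ltji ik dk.
have dj : d j = (d k).+1 by rewrite -dij.
have jv0 : j != v0 by apply: contra_eqN dj => /eqP ->; rewrite depth_root.
have [fle _] := s_bfs (s_full j) jv0 ltji.
have [ej pj] := parentP jv0; have dpj := depth_parent dj.
have [<-//|npk] := eqVneq (parent j) k.
rewrite e_sym; apply: (@later_nbr_above (parent j)) => //.
- rewrite ltn_neqAle (inj_eq pos_inj) npk pj (leq_trans fle) //.
  exact: find_le_pos.
- by rewrite e_sym.
- by rewrite dpj.
Qed.

Lemma bfs_labeling_closed i j k : e j i -> e i k -> j != k ->
  (pos i < pos j /\ pos i < pos k) \/ (pos j < pos i /\ pos k < pos i) -> e j k.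
Proof.
move=> ji ik jk; have ij : e i j by rewrite e_sym.
have ki : e k i by rewrite e_sym.
have l1 := depth_edge ij; have l2 := depth_edge ji.
have l3 := depth_edge ik; have l4 := depth_edge ki.
have [dE|dE] := eqVneq (d j) (d k); first by move=> _; apply: layer_clique.
(* Exactly one of [j], [k] shares the layer of [i]; the other lies in the next layer in the first
   case and in the previous one in the second. *)
case=> [] [ltj ltk]; have m1 := depth_mono (ltnW ltj); have m2 := depth_mono (ltnW ltk).
- have [dj|dj] := eqVneq (d i) (d j).
    by apply: (later_nbr_above dj) => //; nat_lia.
  by rewrite e_sym; apply: (@later_nbr_above i) => //; nat_lia.
- have [dj|dj] := eqVneq (d i) (d j).
    by apply: (earlier_nbr_below dj) => //; nat_lia.
  by rewrite e_sym; apply: (@earlier_nbr_below i) => //; nat_lia.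
Qed.

End Closed.

End Layers.

Theorem theorem4p1 (T : finType) (e : rel T)
    (e_sym : symmetric e) (e_irr : irreflexive e)
    (e_conn : connected_graph e) (e_chordal : chordal e)
    (e_claw_free : claw_free e) (e_narrow : narrow e)
    (lab : T -> nat) (lab_alg : produced_by_algorithm e lab) :
  closed_labeling e lab.
Proof.
have [v0 [s [v0_start /(label_from_output e_sym)[us full root gr] labE]]] := lab_alg.
have size_s : size s = #|T|.
  by rewrite -(card_uniqP us); apply: eq_card => v; rewrite full.
split; first split.
- by move=> u v; rewrite !labE => -[/(pos_inj v0 full)].
- move=> k; split=> [/andP[k0 kT]|[v <-]].
    exists (nth v0 s k.-1); rewrite labE index_uniq ?prednK //.
    by rewrite size_s; case: (k) k0 kT.
  by rewrite labE -size_s index_mem full.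
move=> i j k ji ik jk; rewrite !labE !ltnS.
exact: (bfs_labeling_closed e_sym e_irr e_conn e_chordal e_claw_free e_narrow
  v0_start us full root gr).
Qed.
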